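(* Every cactus is in $B_1^m$.
   Context: A cactus is a connected graph in which any two simple cycles have at most one vertex in common. An EPG representation of a graph is a set of paths on a rectangular grid (sequences of grid points joined consecutively by grid edges), one per vertex, such that two vertices are adjacent iff their paths share a grid edge. A bend is a point of a path where a horizontal and a vertical grid edge of the path meet; a path is monotonic if it is ascending in both columns and rows. $B_1^m$ is the class of graphs having an EPG representation in which every path is monotonic and has at most one bend. *)

(* Defs.v *)
From mathcomp Require Import all_boot.
Set Implicit Arguments. Unset Strict Implicit. Unset Printing Implicit Defensive.

Definition simple_graph (T : finType) (e : rel T) : Prop :=
  symmetric e /\ irreflexive e.

Definition connected_graph (T : finType) (e : rel T) : Prop :=
  forall x y : T, connect e x y.

Definition simple_cycle (T : finType) (e : rel T) (c : seq T) : Prop :=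
  [/\ uniq c, 3 <= size c & cycle e c].

Definition cycle_edge (T : finType) (c : seq T) (x y : T) : bool :=
  ((x \in c) && (next c x == y)) || ((y \in c) && (next c y == x)).

Definition same_cycle (T : finType) (c1 c2 : seq T) : Prop :=
  forall x y : T, cycle_edge c1 x y = cycle_edge c2 x y.

Definition cactus (T : finType) (e : rel T) : Prop :=
  [/\ simple_graph e, connected_graph e &
      forall c1 c2 : seq T, simple_cycle e c1 -> simple_cycle e c2 ->
        ~ same_cycle c1 c2 -> #|[predI mem c1 & mem c2]| <= 1].

(** * Grid paths (grid points are pairs (column, row) of naturals). *)

Definition point := (nat * nat)%type.

Definition grid_adj (a b : point) : bool :=
  ((a.2 == b.2) && ((a.1.+1 == b.1) || (b.1.+1 == a.1))) ||
  ((a.1 == b.1) && ((a.2.+1 == b.2) || (b.2.+1 == a.2))).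

Definition grid_path (p : seq point) : Prop :=
  match p with [::] => False | a :: q => path grid_adj a q end.

Definition horizontal (a b : point) : bool := a.2 == b.2.

Definition monotonic (p : seq point) : Prop :=
  forall i, i.+1 < size p ->
    ((nth (0,0) p i).1 <= (nth (0,0) p i.+1).1) &&
    ((nth (0,0) p i).2 <= (nth (0,0) p i.+1).2).

Definition bend_at (p : seq point) (i : nat) : bool :=
  [&& 0 < i, i.+1 < size p &
      horizontal (nth (0,0) p i.-1) (nth (0,0) p i) !=
      horizontal (nth (0,0) p i) (nth (0,0) p i.+1)].

Definition nbends (p : seq point) : nat := count (bend_at p) (iota 0 (size p)).

Definition path_edges (p : seq point) : seq (point * point) := zip p (behead p).

Definition share_edge (p q : seq point) : Prop :=
  exists a b : point, (a, b) \in path_edges p /\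
    ((a, b) \in path_edges q \/ (b, a) \in path_edges q).

Definition EPG_rep (T : finType) (e : rel T) (P : T -> seq point) : Prop :=
  (forall x, grid_path (P x)) /\
  (forall x y, x != y -> (e x y <-> share_edge (P x) (P y))).

Definition in_B1m (T : finType) (e : rel T) : Prop :=
  exists P : T -> seq point, EPG_rep e P /\
    forall x, monotonic (P x) /\ nbends (P x) <= 1.

(* Main.v *)
Require Import Defs.
From mathcomp Require Import all_boot zify.

Set Implicit Arguments.
Unset Strict Implicit.
Unset Printing Implicit Defensive.

(* Grow a set S of vertices, represented by monotonic one-bend paths in which every
   vertex owns a private grid edge, and such that no path outside S joins two
   different vertices of S (S has no ear). For an edge from v in S to u outside S,
   either v has a second neighbour connected to u outside S, which yields a cycle
   meeting S only in v, or it has none. In a cactus a cycle has no chord and no ear, so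
   S can be enlarged by the whole cycle in the first case and by u in the second. To draw the new vertices, refine the grid
   by a scaling, so that all rows and columns strictly between the old ones are empty,
   and attach a small drawing to the private edge of v. *)

(** * Monotonic paths with one bend *)

(* [LPath true x0 y0 x1 y1] goes from (x0, y0) to (x1, y1) first up, then right;
   [LPath false x0 y0 x1 y1] goes first right, then up. *)
Record lpath := LPath {
  up_first : bool; lx0 : nat; ly0 : nat; lx1 : nat; ly1 : nat }.

Definition lpath_wf (l : lpath) : bool := (lx0 l <= lx1 l) && (ly0 l <= ly1 l).

(* [(true, x, y)] stands for the grid edge from (x, y) to (x + 1, y), and
   [(false, x, y)] for the one from (x, y) to (x, y + 1). *)
Definition gedge := (bool * nat * nat)%type.

Definition in_lpath (g : gedge) (l : lpath) : bool :=
  let: (h, x, y) := g in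
  if h then [&& lx0 l <= x, x < lx1 l & y == if up_first l then ly1 l else ly0 l]
  else [&& ly0 l <= y, y < ly1 l & x == if up_first l then lx0 l else lx1 l].

Definition meet (l l' : lpath) : Prop := exists g, in_lpath g l && in_lpath g l'.

Lemma meetC l l' : meet l l' -> meet l' l.
Proof. by case=> g; rewrite andbC => H; exists g. Qed.

Definition gedge_ends (g : gedge) : point * point :=
  let: (h, x, y) := g in ((x, y), if h then (x.+1, y) else (x, y.+1)).

(** [minn] stops the first coordinate of travel at the corner, and truncated subtraction holds the
    other one at its start until the corner is reached. *)
Definition lpath_point (l : lpath) (i : nat) : point :=
  if up_first l
  then (lx0 l + (i - (ly1 l - ly0 l)), minn (ly0 l + i) (ly1 l))
  else (minn (lx0 l + i) (lx1 l), ly0 l + (i - (lx1 l - lx0 l))).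

Definition lpath_size (l : lpath) := ((lx1 l - lx0 l) + (ly1 l - ly0 l)).+1.

Definition lpath_seq (l : lpath) : seq point :=
  mkseq (lpath_point l) (lpath_size l).

Lemma lpath_seq_path l : lpath_wf l -> grid_path (lpath_seq l).
Proof.
move=> wfl; rewrite /grid_path.
case E: (lpath_seq l) => [|a q].
  by move/(congr1 size): E; rewrite size_mkseq.
apply/(pathP (0, 0)) => i lti.
have Es : (size q).+1 = lpath_size l by rewrite -[LHS]/(size (a :: q)) -E size_mkseq.
have nq j : j <= size q -> nth (0, 0) (a :: q) j = lpath_point l j.
  by move=> lej; rewrite -E nth_mkseq // -Es ltnS.
rewrite nq 1?ltnW // -[nth _ q i]/(nth (0, 0) (a :: q) i.+1) nq //.
move: wfl Es lti; rewrite /lpath_wf /lpath_size /grid_adj /lpath_point.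
by case: (up_first l) => /=; lia.
Qed.

Lemma lpath_seq_monotonic l : monotonic (lpath_seq l).
Proof.
move=> i; rewrite size_mkseq => lti; rewrite !nth_mkseq ?(ltnW lti) //.
by rewrite /lpath_point; case: (up_first l) => /=; lia.
Qed.

Lemma lpath_seq_nbends l : lpath_wf l -> nbends (lpath_seq l) <= 1.
Proof.
move=> wfl; rewrite /nbends.
(* [d] is the index of the corner, the only place where the direction can change. *)
pose d := if up_first l then ly1 l - ly0 l else lx1 l - lx0 l.
suff sub : subpred (bend_at (lpath_seq l)) (pred1 d).
  by rewrite (leq_trans (sub_count sub _)) // count_uniq_mem ?iota_uniq // leq_b1.
move=> i /and3P[i_gt0]; rewrite size_mkseq => lti.
have lti' := ltnW lti; have lti'' : i.-1 < lpath_size l by lia.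
rewrite !nth_mkseq // /horizontal /= /d; move: wfl i_gt0 lti.
rewrite /lpath_wf /lpath_size /lpath_point.
by case: (up_first l) => /=; lia.
Qed.

Lemma path_edgesP (p : seq point) a b :
  reflect (exists2 i, i.+1 < size p & nth (0, 0) p i = a /\ nth (0, 0) p i.+1 = b)
    ((a, b) \in path_edges p).
Proof.
have szp : size (path_edges p) = (size p).-1.
  by rewrite size_zip size_behead; apply/minn_idPr/leq_pred.
apply: (iffP (nthP ((0, 0), (0, 0)))) => [[i]|[i lti [<- <-]]].
  rewrite szp => lti; rewrite nth_zip_cond -/(path_edges p) szp lti.
  by rewrite nth_behead => -[<- <-]; exists i => //; lia.
exists i; first by rewrite szp; lia.
rewrite nth_zip_cond -/(path_edges p) szp nth_behead.
by have -> : i < (size p).-1 by lia.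
Qed.

Lemma path_edges_lpath l a b : lpath_wf l ->
  (a, b) \in path_edges (lpath_seq l) <->
  exists2 g, in_lpath g l & gedge_ends g = (a, b).
Proof.
move=> wfl; split=> [/path_edgesP[i]|[[[h x] y]]].
  rewrite size_mkseq => lti; rewrite !nth_mkseq ?(ltnW lti) // => -[<- <-].
  pose d := if up_first l then ly1 l - ly0 l else lx1 l - lx0 l.
  (* Step [i] is horizontal on the first leg of a right-first path and on the second leg of an
     up-first one, whence the exclusive or. *)
  exists ((i < d) (+) up_first l, (lpath_point l i).1, (lpath_point l i).2).
    move: wfl lti; rewrite /in_lpath /lpath_wf /lpath_size /lpath_point /d.
    by case: (up_first l); case: (ltnP i _) => /=; lia.
  move: wfl lti; rewrite /lpath_wf /lpath_size /lpath_point /d.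
  by case: (up_first l); case: (ltnP i _) => /= *; congr (_, (_, _)); lia.
move=> gl [<- <-]; apply/path_edgesP.
(* Along a monotonic path, the index of a point is its Manhattan distance from the start. *)
exists ((x - lx0 l) + (y - ly0 l)).
  by move: wfl gl; rewrite size_mkseq /lpath_wf /lpath_size /=; case: h; case: (up_first l); lia.
rewrite !nth_mkseq; first last.
- by move: wfl gl; rewrite /lpath_wf /lpath_size /=; case: h; case: (up_first l); lia.
- by move: wfl gl; rewrite /lpath_wf /lpath_size /=; case: h; case: (up_first l); lia.
move: wfl gl; rewrite /lpath_wf /lpath_point /=.
by case: h; case: (up_first l) => /= *; split; congr (_, _); lia.
Qed.

Lemma share_edge_lpath l l' : lpath_wf l -> lpath_wf l' ->
  share_edge (lpath_seq l) (lpath_seq l') <-> meet l l'.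
Proof.
move=> wfl wfl'; split.
  case=> a [b [/(path_edges_lpath _ _ wfl)[[[h x] y] gl gE]]].
  case=> /(path_edges_lpath _ _ wfl')[[[h' x'] y'] gl' gE'].
    exists (h, x, y); rewrite gl.
    suff -> : (h, x, y) = (h', x', y') by [].
    by move: gE; rewrite -gE'; case: h {gl}; case: h' {gl' gE'} => /= -[*];
      congr (_, _, _); lia.
  (* Both paths traverse their edges rightwards or upwards, so neither can use an edge of the other
     backwards. *)
  by exfalso; move: gE gE' => /= [<- <-]; case: h {gl}; case: h' {gl'} => /= -[*]; lia.
case=> g /andP[gl gl']; exists (gedge_ends g).1, (gedge_ends g).2.
split; last left; apply/path_edges_lpath => //; exists g => //; exact: surjective_pairing.
Qed.

(** * Transposing and scaling the grid *)

Definition lpath_tr (l : lpath) : lpath :=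
  LPath (~~ up_first l) (ly0 l) (lx0 l) (ly1 l) (lx1 l).

Definition gedge_tr (g : gedge) : gedge := let: (h, x, y) := g in (~~ h, y, x).

Lemma gedge_trK : involutive gedge_tr.
Proof. by case=> [[h x] y]; rewrite /= negbK. Qed.

Lemma lpath_wf_tr l : lpath_wf (lpath_tr l) = lpath_wf l.
Proof. by rewrite /lpath_wf andbC. Qed.

Lemma in_lpath_tr g l : in_lpath g (lpath_tr l) = in_lpath (gedge_tr g) l.
Proof. by case: g => [[[] x] y]; case: l => [[] *]. Qed.

Lemma meet_tr l l' : meet (lpath_tr l) (lpath_tr l') <-> meet l l'.
Proof.
split=> -[g H]; exists (gedge_tr g); first by rewrite -!in_lpath_tr.
by rewrite !in_lpath_tr gedge_trK.
Qed.

(* The offset [K] leaves free rows below every scaled path. *)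
Definition lpath_scale (K : nat) (l : lpath) : lpath :=
  LPath (up_first l) (K * (lx0 l).+1) (K * (ly0 l).+1)
    (K * (lx1 l).+1) (K * (ly1 l).+1).

Lemma lpath_wf_scale K l : lpath_wf l -> lpath_wf (lpath_scale K l).
Proof. by case/andP=> *; rewrite /lpath_wf /= !leq_mul. Qed.

(** Scaling turns the edge [g] into [K] unit edges; for [j < K] this is the piece number [j],
    counted from 0. *)
Definition gedge_scale (K j : nat) (g : gedge) : gedge :=
  let: (h, x, y) := g in
  (h, K * x.+1 + (if h then j else 0), K * y.+1 + (if h then 0 else j)).

Lemma in_lpath_scale K j g l : j < K ->
  in_lpath (gedge_scale K j g) (lpath_scale K l) = in_lpath g l.
Proof.
move=> ltj; have K_gt0 : 0 < K by lia.
have le_ a b : (K * a <= K * b + j) = (a <= b).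
  apply/idP/idP => [H|H]; last by nia.
  by rewrite leqNgt; apply/negP; nia.
have lt_ a b : (K * b + j < K * a) = (b < a) by rewrite ltnNge le_ -ltnNge.
have eq_ a b : (K * a + 0 == K * b) = (a == b) by rewrite addn0 eqn_pmul2l.
by case: g l => [[[] x] y] [[] x0 y0 x1 y1];
  rewrite /= le_ lt_ eq_ !ltnS eqSS.
Qed.

Lemma in_lpath_scaleP K g l : 0 < K -> in_lpath g (lpath_scale K l) ->
  exists g' j, [/\ j < K, in_lpath g' l & g = gedge_scale K j g'].
Proof.
move=> K_gt0 gl.
suff [g' [j [ltj gE]]] : exists g' j, j < K /\ g = gedge_scale K j g'.
  by exists g', j; split=> //; rewrite -(in_lpath_scale _ _ ltj) -gE.
(* The piece number is the remainder modulo [K]. The old coordinate is the quotient minus one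
   because of the offset, which also makes the quotient positive. *)
have dv n m : K * m.+1 <= n -> n = K * (n %/ K).-1.+1 + n %% K.
  move=> le_n; have dn : 0 < n %/ K by rewrite divn_gt0 //; nia.
  by rewrite prednK // mulnC -divn_eq.
case: g gl => [[h x] y].
case: l => b x0 y0 x1 y1; case: h => /= /and3P[lo _ /eqP E].
- exists (true, (x %/ K).-1, if b then y1 else y0), (x %% K).
  rewrite ltn_mod; split=> //=; rewrite -(dv _ _ lo) addn0 E.
  by case: (b).
exists (false, if b then x0 else x1, (y %/ K).-1), (y %% K).
rewrite ltn_mod; split=> //=; rewrite -(dv _ _ lo) addn0 E.
by case: (b).
Qed.

Lemma meet_scale K l l' : 0 < K ->
  meet (lpath_scale K l) (lpath_scale K l') <-> meet l l'.
Proof.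
move=> K_gt0; split=> -[g /andP[gl gl']].
  have [g' [j [ltj _ gE]]] := in_lpath_scaleP K_gt0 gl.
  by exists g'; rewrite -(in_lpath_scale _ l ltj) -(in_lpath_scale _ l' ltj) -gE gl.
by exists (gedge_scale K 0 g); rewrite !in_lpath_scale ?gl.
Qed.

(** * Attaching a cycle to a horizontal grid edge *)

(** A drawing of a chain of [k] new vertices next to the part of row [R] where the path of [v] runs
    from column [X] to [X + W]. The bounds on rows and columns keep it away from the other old
    paths. A horizontal private edge must avoid row [R], since [v] covers that row, and
    [gadget_free] leaves [v] a private edge there. *)
Record gadget (X R W k : nat) (q : nat -> lpath) : Prop := Gadget {
  gadget_wf : forall i, i < k -> lpath_wf (q i);
  gadget_hor : forall i x y, i < k -> in_lpath (true, x, y) (q i) ->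
    [/\ X <= x, x < X + W, R <= y + 2 & y <= R + 2];
  gadget_ver : forall i x y, i < k -> in_lpath (false, x, y) (q i) ->
    X < x < X + W;
  gadget_base : forall i, i < k ->
    (exists x, in_lpath (true, x, R) (q i)) <-> i = 0 \/ i.+1 = k;
  gadget_meet : forall i j, i < j -> j < k -> meet (q i) (q j) <-> j = i.+1;
  gadget_private : forall i, i < k -> exists h x y,
    [/\ in_lpath (h, x, y) (q i), h -> y <> R &
        forall j, j < k -> in_lpath (h, x, y) (q j) -> j = i];
  gadget_free : exists2 x, X <= x < X + W &
    forall i, i < k -> ~~ in_lpath (true, x, R) (q i) }.

Lemma gadget1 X R : gadget X R 4 1 (fun=> LPath false X R X.+1 R.+1).
Proof.
split=> //.
- by move=> i _; rewrite /lpath_wf /=; lia.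
- by move=> i x y _ /= ?; split; lia.
- by move=> i x y _ /=; lia.
- move=> i lti; split=> [_|_]; first by lia.
  by exists X => /=; lia.
- by move=> i j; lia.
- by move=> i lti; exists false, X.+1, R; split=> /=; lia.
- by exists X.+1 => [|i _ /=]; lia.
Qed.

Lemma gadget2 X R : gadget X R 4 2 (fun i => LPath false X R (X + i.+1) R.+1).
Proof.
split=> //.
- by move=> i _; rewrite /lpath_wf /=; lia.
- by move=> i x y lti /= ?; split; lia.
- by move=> i x y lti /=; lia.
- move=> i lti; split=> [_|_]; first by lia.
  by exists X => /=; lia.
- move=> i j ltij ltj; split=> _; first by lia.
  by exists (true, X, R) => /=; lia.
- by move=> i lti; exists false, (X + i.+1), R; split=> /=; lia.
- by exists X.+2 => [|i lti /=]; lia.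
Qed.

(** The vertical parts all lie in column [X + 1], over the row intervals [[R, R + 2]],
    [[R - 1, R + 1]] and [[R - 2, R]], so only consecutive ones share an edge; the outer two paths
    each take one edge of row [R]. *)
Definition gadget3_path X R (i : nat) : lpath :=
  match i with
  | 0 => LPath false X R X.+1 R.+2
  | 1 => LPath true X.+1 R.-1 X.+2 R.+1
  | _ => LPath true X.+1 R.-2 X.+2 R
  end.

Lemma gadget3 X R : 1 < R -> gadget X R 4 3 (gadget3_path X R).
Proof.
move=> R_gt1; split=> //.
- by move=> [|[|[|i]]] //= _; rewrite /lpath_wf /=; lia.
- by move=> [|[|[|i]]] x y //= _ ?; split; lia.
- by move=> [|[|[|i]]] x y //= _; lia.
- move=> [|[|[|i]]] //= _; split.
  + by left.
  + by exists X; lia.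
  + by case=> x; lia.
  + by lia.
  + by right.
  + by exists X.+1; lia.
- move=> [|[|[|i]]] [|[|[|j]]] //= _ _; split=> //.
  + by exists (false, X.+1, R) => /=; lia.
  + by case=> -[[[] x] y] /=; lia.
  + by exists (false, X.+1, R.-1) => /=; lia.
- move=> [|[|[|i]]] //= _.
  + by exists false, X.+1, R.+1; split=> //=; [lia | case=> [|[|[|j]]] //=; lia].
  + by exists true, X.+1, R.+1; split=> //=; [lia | lia | case=> [|[|[|j]]] //=; lia].
  + by exists false, X.+1, R.-2; split=> //=; [lia | case=> [|[|[|j]]] //=; lia].
- by exists X.+2 => [|[|[|[|i]]] //= _]; lia.
Qed.

(* The first and the last path climb from the base row; the others form a chain
   along row [R + 2], hooked at both ends into the columns of these two. *)
Definition gadget4_path X R k (i : nat) : lpath :=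
  if i == 0 then LPath false X R X.+1 R.+2
  else if i.+1 == k then LPath false (X + 2 * k - 6) R (X + 2 * k - 5) R.+2
  else LPath true (X + 2 * i - 1)
         (if (i == 1) || (i.+2 == k) then R.+1 else R.+2) (X + 2 * i + 2) R.+2.

(** Link [i] of the chain spans columns [X + 2 * i - 1] to [X + 2 * i + 2]: it shares one edge with
    the next link, none with later links, and keeps the edge starting at [X + 2 * i] to itself. For
    [k = 3] the first and the last path would coincide, hence the separate drawing above. *)
Lemma gadget4 X R k : 3 < k -> gadget X R (2 * k) k (gadget4_path X R k).
Proof.
move=> k_gt3; rewrite /gadget4_path; split=> //.
- move=> i lti; rewrite /lpath_wf.
  by case: eqP => ? /=; [lia | case: eqP => ? /=; [lia | case: ifP; lia]].
- move=> i x y lti.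
  by case: eqP => ? /=; [|case: eqP => ? /=] => ?; split; lia.
- move=> i x y lti.
  by case: eqP => ? /=; [lia | case: eqP => ? /=; [lia | case: ifP; lia]].
- move=> i lti; case: eqP => [?|i0] /=.
    by split=> [_|_]; [left | exists X; lia].
  case: eqP => [?|ik] /=; split=> //.
  + by right.
  + by exists (X + 2 * k - 6); lia.
  + by case=> x; lia.
  + by case.
- move=> i j ltij ltj; have -> : (j == 0) = false by lia.
  have -> : (i.+1 == k) = false by lia.
  split.
    case: (i =P 0) => ?; case: (j.+1 =P k) => ? -[[[[] x] y]] /=;
      by repeat (case: ifP => ?); lia.
  move=> ->; have [->|i0] := eqVneq i 0.
    by exists (false, X.+1, R.+1); case: eqP => /=; lia.
  have [ik|ik] := eqVneq i.+2 k.
    by exists (false, X + 2 * k - 5, R.+1) => /=; rewrite orbT /=; lia.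
  by exists (true, X + 2 * i + 1, R.+2) => /=; lia.
- move=> i lti; have [->|i0] := eqVneq i 0.
    exists false, X.+1, R; split=> //=; first by lia.
    by move=> j ltj; case: eqP => //= ?; case: eqP => ? /=; [lia | case: ifP; lia].
  have [ik|ik] := eqVneq i.+1 k.
    exists false, (X + 2 * k - 5), R; split=> //=; first by lia.
    by move=> j ltj; case: eqP => /= ?; [lia | case: eqP => ? /=; [lia | case: ifP; lia]].
  exists true, (X + 2 * i), R.+2; split=> //=; [by lia | by lia |].
  by move=> j ltj; case: eqP => /= ?; [lia | case: eqP => ? /=; lia].
- exists X.+1; first by lia.
  by move=> i lti; case: eqP => /= ?; [lia | case: eqP => ? /=; lia].
Qed.

Lemma gadget_exists X R k : 0 < k -> 1 < R -> exists q, gadget X R (2 * k + 4) k q.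
Proof.
move=> k_gt0 R_gt1.
(* A common width that bounds both 4 and [2 * k], the widths of the four drawings. *)
have widen W q : W <= 2 * k + 4 -> gadget X R W k q -> gadget X R (2 * k + 4) k q.
  move=> leW [wf hor ver base mt priv [x xW fr]]; split=> //.
  - by move=> i x' y' lti /(hor _ _ _ lti) []; split=> //; lia.
  - by move=> i x' y' lti /(ver _ _ _ lti); lia.
  - by exists x => //; lia.
case: k k_gt0 widen => [|[|[|[|k]]]] // _ widen.
- by eexists; apply: widen (gadget1 X R).
- by eexists; apply: widen (gadget2 X R).
- by eexists; apply: widen (gadget3 X R_gt1).
by eexists; apply: widen (@gadget4 X R k.+4 _) => //; lia.
Qed.

(** * Representations of induced subgraphs *)

Record lrep (T : finType) (e : rel T) (S : {set T}) (P : T -> lpath) : Prop := LRep {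
  lrep_wf : forall x, x \in S -> lpath_wf (P x);
  lrep_meet : forall x y, x \in S -> y \in S -> x != y -> e x y <-> meet (P x) (P y);
  lrep_private : forall x, x \in S -> exists2 g, in_lpath g (P x) &
    forall y, y \in S -> in_lpath g (P y) -> y = x }.

Lemma lrep_tr (T : finType) (e : rel T) S P :
  lrep e S P -> lrep e S (fun x => lpath_tr (P x)).
Proof.
case=> wf mt pr; split=> [x xS|x y xS yS xy|x xS].
- by rewrite lpath_wf_tr wf.
- by rewrite mt // meet_tr.
have [g gx gy] := pr x xS; exists (gedge_tr g).
  by rewrite in_lpath_tr gedge_trK.
by move=> y yS; rewrite in_lpath_tr gedge_trK; apply: gy.
Qed.

Lemma lrep_set1 (T : finType) (e : rel T) x :
  lrep e [set x] (fun=> LPath false 0 0 1 0).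
Proof.
split=> // [y z /set1P-> /set1P->|y /set1P->]; first by rewrite eqxx.
by exists (true, 0, 0) => // z /set1P->.
Qed.

Section Extend.

Variables (T : finType) (e : rel T) (S : {set T}) (v : T) (s : seq T).
Hypotheses (e_sym : symmetric e) (vS : v \in S) (s_uniq : uniq s).
Hypotheses (s_gt0 : 0 < size s) (sS : {in s, forall x, x \notin S}).
(** The list [s] is an induced path whose ends, and nothing else, are joined to [S], both through
    [v]. Size one is the case of a single new vertex; larger sizes close a chordless cycle through
    [v]. *)
Hypothesis e_Ss : forall x i, x \in S -> i < size s ->
  e x (nth v s i) <-> x = v /\ (i = 0 \/ i.+1 = size s).
Hypothesis e_ss : forall i j, i < j -> j < size s ->
  e (nth v s i) (nth v s j) <-> j = i.+1.

(* After scaling by [K], the old paths use no horizontal edge on the rows, and no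
   vertical edge on the columns, that are not multiples of [K]; all new paths
   live there, except on the base row, where they only meet [v]. *)
Lemma lrep_extend_hor P a b : lrep e S P -> in_lpath (true, a, b) (P v) ->
  (forall y, y \in S -> in_lpath (true, a, b) (P y) -> y = v) ->
  exists P', lrep e (S :|: [set x in s]) P'.
Proof.
move=> [wf mt pr] gv gu.
(* [K] is the width of the gadget, so the base of the gadget is exactly the image of the private
   edge of [v]. As [K > 2], the gadget reaches no other row that is a multiple of [K]. *)
pose k := size s; pose K := 2 * k + 4; pose X := K * a.+1; pose R := K * b.+1.
have K_gt0 : 0 < K by rewrite /K; lia.
have [q G] : exists q, gadget X R K k q.
  by apply: gadget_exists => //; rewrite /R /K; nia.
have leK m n j : j < K -> K * m <= K * n + j -> m <= n.
  by move=> ltj; apply: contraTT; rewrite -!ltnNge -(leq_pmul2l K_gt0) mulnS; lia.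
have modX x : X < x < X + K -> forall d, x <> K * d.
  move=> /andP[H1 H2] d xE; rewrite {x}xE /X in H1 H2.
  by rewrite ltn_pmul2l // in H1; have := leK d a.+1 K.-1; lia.
have modR y : R <= y + 2 -> y <= R + 2 -> forall d, y = K * d -> y = R.
  move=> H1 H2 d yE; rewrite yE /R in H1 H2 *; have K2 : 2 < K by lia.
  by congr (_ * _); apply/eqP; rewrite eqn_leq (leK d b.+1 2) // (leK b.+1 d 2).
(* Scaled horizontal edges lie on rows, and vertical ones on columns, that are multiples of [K]. The
   only gadget edges of this kind are on row [R], inside the image of the private edge of [v]. *)
have clash i g x : i < k -> x \in S -> in_lpath g (q i) ->
    in_lpath g (lpath_scale K (P x)) -> x = v /\ exists c, g = (true, c, R).
  move=> lti xS gq gx.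
  have [[[h x'] y'] [j [ltj gx' gE]]] := in_lpath_scaleP K_gt0 gx.
  case: h gx' gE => gx' gE; rewrite gE /= in gq.
    have [X1 X2 R1 R2] := gadget_hor G lti gq.
    have yR := modR _ R1 R2 y'.+1 (addn0 _).
    split; last by exists (K * x'.+1 + j); rewrite gE /= yR.
    apply: gu => //; suff [<- <-] : x' = a /\ y' = b by [].
    rewrite /X /R addn0 in X1 X2 yR; split; last first.
      by apply/succn_inj/eqP; rewrite -(eqn_pmul2l K_gt0) yR.
    have := leK a.+1 x'.+1 j ltj X1; have := leK x'.+1 a.+1 K.-1; lia.
  by case: (modX _ (gadget_ver G lti gq) x'.+1); rewrite addn0.
have baseE c : X <= c -> (true, c, R) = gedge_scale K (c - X) (true, a, b).
  by move=> leX; rewrite /= -/X -/R addn0 subnKC.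
have vbase i c : i < k -> in_lpath (true, c, R) (q i) ->
    in_lpath (true, c, R) (lpath_scale K (P v)).
  move=> lti gq; have [X1 X2 _ _] := gadget_hor G lti gq.
  by rewrite baseE // in_lpath_scale //; lia.
pose P' x := if x \in S then lpath_scale K (P x) else q (index x s).
have PS x : x \in S -> P' x = lpath_scale K (P x) by rewrite /P' => ->.
have Ps i : i < k -> P' (nth v s i) = q i.
  by move=> lti; rewrite /P' (negPf (sS _)) ?mem_nth // index_uniq.
have cases x : x \in S :|: [set x in s] -> x \in S \/ exists2 i, i < k & x = nth v s i.
  rewrite !inE => /orP[|xs]; [by left | right; exists (index x s)].
    by rewrite index_mem.
  by rewrite nth_index.
have mSs x i : x \in S -> i < k -> e x (nth v s i) <-> meet (P' x) (P' (nth v s i)).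
  move=> xS lti; rewrite e_Ss // PS // Ps //; split.
    by case=> -> /(gadget_base G lti)[c gq]; exists (true, c, R); rewrite gq (vbase i).
  case=> g /andP[gx gq]; have [-> [c gE]] := clash _ _ _ lti xS gq gx.
  by split=> //; apply/(gadget_base G lti); exists c; rewrite -gE.
exists P'; split.
- move=> x /cases[xS|[i lti ->]]; first by rewrite PS // lpath_wf_scale ?wf.
  by rewrite Ps // (gadget_wf G).
- have mC x y : (e x y <-> meet (P' x) (P' y)) -> (e y x <-> meet (P' y) (P' x)).
    by rewrite e_sym => ->; split; apply: meetC.
  move=> x y /cases[xS|[i lti ->]] /cases[yS|[j ltj ->]] xy.
  + by rewrite mt // !PS // meet_scale.
  + exact: mSs.
  + exact/mC/mSs.
  + have mss i' j' : i' < j' -> j' < k -> e (nth v s i') (nth v s j') <->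
        meet (P' (nth v s i')) (P' (nth v s j')).
      move=> ltij ltj'; rewrite e_ss // !Ps ?(ltn_trans ltij) //.
      by rewrite (gadget_meet G).
    by case: (ltngtP i j) => ij; [apply: mss | apply/mC/mss | rewrite ij eqxx in xy].
- move=> x /cases[xS|[i lti ->]].
    have [->|xv] := eqVneq x v.
      (* The new private edge of [v] is the piece of its old one that the gadget leaves free. *)
      have [c cX cq] := gadget_free G.
      have leX : X <= c by lia.
      exists (true, c, R); first by rewrite baseE // PS // in_lpath_scale //; lia.
      move=> y /cases[yS|[i lti ->]]; last by rewrite Ps // (negPf (cq _ lti)).
      by rewrite baseE // PS // in_lpath_scale; [apply: gu | lia].
    (* For other old vertices any piece of the private edge will do, since by [clash] the gadget
       meets only [v]. *)
    have [g gx gy] := pr x xS; exists (gedge_scale K 0 g).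
      by rewrite PS // in_lpath_scale.
    move=> y /cases[yS|[i lti ->]]; first by rewrite PS // in_lpath_scale //; apply: gy.
    rewrite Ps // => gq; have := clash _ _ x lti xS gq; rewrite in_lpath_scale // => -[] //.
    by move=> xE; rewrite xE eqxx in xv.
  have [h [c [d [gq hd gu']]]] := gadget_private G lti.
  exists (h, c, d); first by rewrite Ps.
  move=> y /cases[yS|[j ltj ->]].
    rewrite PS // => gy; have [_ [c' [hE _ dE]]] := clash _ _ _ lti yS gq gy.
    by case: hd.
  by rewrite Ps // => /gu' ->.
Qed.

(** If the private edge of [v] is vertical, transposing the whole representation makes it
    horizontal. *)
Lemma lrep_extend P : lrep e S P -> exists P', lrep e (S :|: [set x in s]) P'.
Proof.
move=> rP; have [[[h x] y] gv gu] := lrep_private rP vS.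
case: h gv gu => gv gu; first exact: lrep_extend_hor rP gv gu.
apply: (lrep_extend_hor (a := y) (b := x) (lrep_tr rP)); first by rewrite in_lpath_tr.
by move=> z zS; rewrite in_lpath_tr; apply: gu.
Qed.

End Extend.

Lemma lrep_in_B1m (T : finType) (e : rel T) P : lrep e setT P -> in_B1m e.
Proof.
move=> [wf mt _]; exists (fun x => lpath_seq (P x)).
have {}wf x : lpath_wf (P x) by apply: wf.
split; last by move=> x; split; [apply: lpath_seq_monotonic | apply: lpath_seq_nbends].
split=> [x|x y xy]; first exact: lpath_seq_path.
by rewrite mt ?inE // share_edge_lpath.
Qed.

(** * Ears of cycles in a cactus *)

Lemma same_cycle_mem (T : finType) (c d : seq T) : same_cycle c d -> {subset c <= d}.
Proof.
move=> cd x xc; have := cd x (next c x); rewrite {1}/cycle_edge xc eqxx /=.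
move=> /esym/orP[/andP[] // | /andP[yd /eqP <-]].
by rewrite mem_next.
Qed.

Section Cactus.

Variables (T : finType) (e : rel T).
Hypothesis e_cactus : cactus e.

(** Cycles with the same edges have the same vertices, so [z] certifies that [c] and [d] differ,
    while [x] and [y] are two common vertices. *)
Lemma cactus_distinct c d x y z : simple_cycle e c -> simple_cycle e d ->
  x != y -> x \in c -> y \in c -> x \in d -> y \in d -> (z \in c) != (z \in d) -> False.
Proof.
move=> cc cd xy xc yc xd yd zcd; have [_ _ /(_ c d cc cd)] := e_cactus.
have ncd : ~ same_cycle c d.
  move=> cd'; suff sub : c =i d by rewrite sub eqxx in zcd.
  by move=> t; apply/idP/idP; apply: same_cycle_mem => // a b; rewrite cd'.
move=> /(_ ncd); rewrite leqNgt => /negP[].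
have <- : #|[predU1 x & pred1 y]| = 2.
  by rewrite cardU1 card1 inE xy.
apply/subset_leq_card/subsetP => t; rewrite !inE => /orP[]/eqP->; exact/andP.
Qed.

Lemma cycle_split c x y : simple_cycle e c -> x != y -> x \in c -> y \in c ->
  exists c1 c2, [/\ simple_cycle e (x :: c1 ++ y :: c2),
    c =i x :: c1 ++ y :: c2 & next c =1 next (x :: c1 ++ y :: c2)].
Proof.
move=> [uc sc cc] xy xc yc; have [i c' cE] := rot_to xc.
have yc' : y \in c'.
  by have: y \in rot i c by [rewrite mem_rot]; rewrite cE inE eq_sym (negPf xy).
case/splitPr: yc' cE => c1 c2 cE; exists c1, c2; rewrite -cE; split.
- by split; rewrite ?rot_uniq ?size_rot ?rot_cycle.
- by move=> t; rewrite mem_rot.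
- by move=> t; rewrite next_rot.
Qed.

(** Otherwise replacing one arc of [c] between [x] and [y] by [q] gives a second cycle through both,
    and it contains a vertex off [c]. *)
Lemma cactus_no_ear c x y q : simple_cycle e c -> x \in c -> y \in c ->
  q != [::] -> uniq q -> {in q, forall z, z \notin c} -> path e x (rcons q y) -> x = y.
Proof.
move=> cc xc yc q0 uq qc pq; apply/eqP/contraT => xy; exfalso.
have [c1 [c2 [[uc sc pc] cE _]]] := cycle_split cc xy xc yc.
case: q q0 uq qc pq => // z q _ uq qc pq.
have zc := qc z (mem_head _ _).
apply: (cactus_distinct (d := x :: (z :: q) ++ y :: c2) cc _ xy xc yc (z := z)).
- have subc : subseq (x :: y :: c2) (x :: c1 ++ y :: c2).
    by rewrite /= eqxx suffix_subseq ?suffix_suffix.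
  split.
  - rewrite -cat1s (perm_uniq (permEl (perm_catCA _ _ _))) cat_uniq uq cat1s.
    rewrite (subseq_uniq subc uc) andbT; apply/hasPn => t /(mem_subseq subc).
    by rewrite -cE; apply/contraL/qc.
  - by rewrite /= size_cat /= addnS.
  move: pc; rewrite /cycle (rcons_cat x c1) cat_path => /andP[_ /andP[_ pc2]].
  rewrite (rcons_cat x (z :: q)) cat_path.
  by move: pq; rewrite rcons_path => /andP[-> /= ->].
- by rewrite inE eqxx.
- by rewrite inE mem_cat mem_head !orbT.
by rewrite (negPf zc) !inE eqxx orbT.
Qed.

(** If both arcs between [x] and [y] have inner vertices, shortcutting one by the edge gives a
    second cycle through [x] and [y] that misses a vertex of [c]. *)
Lemma cactus_no_chord c x y : simple_cycle e c -> x \in c -> y \in c -> e x y ->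
  next c x = y \/ next c y = x.
Proof.
move=> cc xc yc exy; have [[e_sym e_irr] _ _] := e_cactus.
have xy : x != y by apply: contraTneq exy => ->; rewrite e_irr.
have [c1 [c2 [[uc sc pc] cE nE]]] := cycle_split cc xy xc yc.
rewrite !nE; case: c1 => [|z c1] in uc sc pc cE nE *.
  by left; rewrite /= eqxx.
case: c2 => [|t c2] in uc sc pc cE nE *.
  (* Here [y] ends the list, and [next] wraps around to the head [x] as the default of [nth]. *)
  right; rewrite next_nth -cE yc nth_default //.
  move: uc; rewrite -cat_cons cat_uniq => /and3P[_ /hasPn ny _].
  by rewrite index_cat (negPf (ny y _)) ?mem_head //= eqxx size_cat /= addn0 addn1.
exfalso.
have subc : subseq (x :: y :: t :: c2) (x :: (z :: c1) ++ y :: t :: c2).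
  exact: cat_subseq (subseq_refl [:: x]) (suffix_subseq (z :: c1) _).
apply: (cactus_distinct (d := x :: y :: t :: c2) cc _ xy xc yc (z := z)).
- split=> //; first exact: subseq_uniq subc uc.
  move: pc; rewrite /cycle rcons_cat cat_path => /andP[_ /= /andP[_ ->]].
  by rewrite exy.
- by rewrite inE eqxx.
- by rewrite !inE eqxx orbT.
have zd : z \notin x :: y :: t :: c2.
  case/and3P: uc => xz zc _; rewrite inE negb_or; apply/andP; split.
    by apply: contraNneq xz => <-; rewrite mem_head.
  by apply: contraNN zc => z2; rewrite mem_cat z2 orbT.
by rewrite (negPf zd) cE !inE eqxx orbT.
Qed.

(** * Growing an ear-free set *)

Definition outside (S : {set T}) : rel T :=
  fun x y => [&& e x y, x \notin S & y \notin S].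

(** The case [a = b] is included: a vertex outside [S] has at most one neighbour in [S]. *)
Definition ear_free (S : {set T}) : Prop :=
  forall a b x y, a \notin S -> b \notin S -> connect (outside S) a b ->
    x \in S -> y \in S -> e x a -> e y b -> x = y.

Lemma ear_free_set1 x : ear_free [set x].
Proof. by move=> a b y z _ _ _ /set1P-> /set1P->. Qed.

Lemma outside_sym S : symmetric (outside S).
Proof.
have [[e_sym _] _ _] := e_cactus.
by move=> x y; rewrite /outside [e x y]e_sym [(x \notin S) && _]andbC.
Qed.

Lemma connect_sym_outside S a b :
  connect (outside S) a b = connect (outside S) b a.
Proof. exact/sym_connect_sym/outside_sym. Qed.

Lemma sub_outside (S S' : {set T}) : S \subset S' -> subrel (outside S') (outside S).
Proof.
move=> /subsetP sub x y /and3P[exy xS yS]; apply/and3P.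
by split=> //; [apply: contraNN xS | apply: contraNN yS]; apply: sub.
Qed.

Lemma connect_outsideW (S S' : {set T}) : S \subset S' ->
  subrel (connect (outside S')) (connect (outside S)).
Proof.
by move=> sub; apply: connect_sub => x y /(sub_outside sub); apply: connect1.
Qed.

Lemma path_outside (S : {set T}) x p : x \notin S -> path (outside S) x p ->
  {in x :: p, forall z, z \notin S} /\ path e x p.
Proof.
elim: p x => [|y p IH] x xS /=; first by split=> // z; rewrite inE => /eqP->.
case/andP=> /and3P[-> _ yS] /(IH _ yS)[yp ->]; split=> // z.
by rewrite inE => /orP[/eqP->//|/yp].
Qed.

Lemma boundary_edge (S : {set T}) : S != set0 -> S != setT ->
  exists v u, [/\ v \in S, u \notin S & e v u].
Proof.
have [_ conn _] := e_cactus.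
move=> /set0Pn[x xS]; rewrite -subTset => /subsetPn[y _ yS].
have /connectP[p pp yE] := conn x y; rewrite {y}yE in yS.
elim: p x xS pp yS => [|z p IH] x xS /=; first by rewrite xS.
case/andP=> exz pp lS; have [zS|zS] := boolP (z \in S); first exact: IH zS pp lS.
by exists x, z.
Qed.

(** * Adding one vertex or one cycle *)

Section Step.

Variables (S : {set T}) (v u : T).
Hypotheses (S_ear : ear_free S) (vS : v \in S) (uS : u \notin S) (evu : e v u).

Lemma ear_free_add1 :
  (forall w, w \notin S -> connect (outside S) u w -> e v w -> w = u) ->
  ear_free (S :|: [set z in [:: u]]).
Proof.
have [[e_sym _] _ _] := e_cactus.
move=> no_cycle a b x y.
rewrite !inE !negb_or => /andP[aS au] /andP[bS bu] /connect_outsideW.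
move/(_ S (subsetUl _ _)) => ab.
(* An ear with one end at [u], prolonged through [u] to [v], becomes an ear of [S]; so its other end
   is [v], and [b'] is a forbidden second neighbour of [v]. *)
have aux a' b' y' : a' \notin S -> b' \notin S -> b' != u ->
    connect (outside S) a' b' -> y' \in S -> e u a' -> e y' b' -> False.
  move=> a'S b'S b'u ab' y'S eua eyb.
  have ub : connect (outside S) u b'.
    by apply: connect_trans ab'; apply/connect1/and3P.
  have vy : v = y' by apply: (S_ear uS b'S ub).
  by move/eqP: b'u; apply; apply: no_cycle => //; rewrite vy.
case/orP=> [xS|/eqP->] /orP[yS|/eqP->] // exa eyb.
- exact: (S_ear aS bS ab).
- by case: (aux b a x) => //; rewrite connect_sym_outside.
- by case: (aux a b y).
Qed.

Lemma lrep_extend1 P :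
  lrep e S P -> exists P', lrep e (S :|: [set z in [:: u]]) P'.
Proof.
have [[e_sym _] _ _] := e_cactus.
apply: (lrep_extend (v := v)) => //.
- by move=> z; rewrite inE => /eqP->.
- move=> x [|i] // xS _; split=> [exu|[->] //].
  by split; [apply: (S_ear uS uS (connect0 _ _)) | left].
- by move=> i [|j].
Qed.

Variable p : seq T.
Hypotheses (p_path : path (outside S) u p) (p_uniq : uniq (u :: p)).
Hypotheses (p0 : p != [::]) (evp : e v (last u p)).

Let s := u :: p.
Let c := v :: s.

Let sS : {in s, forall z, z \notin S}.
Proof. by have [] := path_outside uS p_path. Qed.

Let vs : v \notin s.
Proof. by apply/negP => /sS; rewrite vS. Qed.

Let connect_s z : z \in s -> connect (outside S) u z.
Proof. by apply: path_connect. Qed.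

Let c_path : path e v (rcons s v).
Proof.
have [[e_sym _] _ _] := e_cactus; have [_ pp] := path_outside uS p_path.
by rewrite /= rcons_path evu pp e_sym.
Qed.

Let c_cycle : simple_cycle e c.
Proof.
split; last exact: c_path; first by rewrite /c cons_uniq vs.
by rewrite /c /s; case: (p) p0.
Qed.

(** Ears with both ends in [S] are excluded by [S_ear], ears with both ends on [c] by
    [cactus_no_ear]. A mixed ear, continued along [s] to [u], shows that its end in [S] is [v],
    which lies on [c] too. *)
Lemma ear_free_cycle : ear_free (S :|: [set z in s]).
Proof.
have [[e_sym _] _ _] := e_cactus.
move=> a b x y aS' bS' ab.
have nc z : z \notin S :|: [set z in s] -> z \notin c.
  rewrite in_setU in_set negb_or => /andP[zS zs]; rewrite /c in_cons negb_or zs andbT.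
  by apply: contraNneq zS => ->.
have base a' x' y' : a' \notin S :|: [set z in s] -> x' \in S -> y' \in s ->
    connect (outside S) a' y' -> e x' a' -> x' = v.
  rewrite in_setU negb_or => /andP[a'S _] x'S y's ay exa.
  apply: (S_ear a'S uS _ x'S vS exa evu).
  by apply: connect_trans ay _; rewrite connect_sym_outside connect_s.
have ear : x \in c -> y \in c -> e x a -> e y b -> x = y.
  move=> xc yc exa eyb; case/connectP: ab => q0 /shortenP[q pq uq _] bE.
  have [qS pe] := path_outside aS' pq.
  apply: (cactus_no_ear (q := a :: q) c_cycle xc yc) => //.
    by move=> z /qS /nc.
  by rewrite /= rcons_path exa pe e_sym -bE.
have ab' := connect_outsideW (subsetUl S _) ab.
have ba' : connect (outside S) b a by rewrite connect_sym_outside.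
have notS z : z \notin S :|: [set z in s] -> z \notin S.
  by rewrite inE negb_or => /andP[].
have [aS bS] := (notS a aS', notS b bS').
have sc z : z \in s -> z \in c by move=> zs; rewrite /c in_cons zs orbT.
have to_s z t : t \notin S -> z \in s -> e z t -> connect (outside S) t z.
  by move=> tS zs ezt; apply/connect1/and3P; split=> //; [rewrite e_sym | apply: sS].
rewrite 2!in_setU !in_set => /orP[xS|xs] /orP[yS|ys] exa eyb.
- exact: (S_ear aS bS ab').
- have xv : x = v.
    by apply: (base a x y) => //; apply: connect_trans ab' _; apply: to_s.
  by apply: ear => //; [rewrite xv mem_head | apply: sc].
- have yv : y = v.
    by apply: (base b y x) => //; apply: connect_trans ba' _; apply: to_s.
  by apply: ear => //; [apply: sc | rewrite yv mem_head].
by apply: ear => //; apply: sc.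
Qed.

Lemma lrep_extend_cycle P :
  lrep e S P -> exists P', lrep e (S :|: [set z in s]) P'.
Proof.
have [[e_sym _] _ _] := e_cactus.
have sc i : i < size s -> nth v s i \in c by move=> lti; rewrite /c in_cons mem_nth ?orbT.
(* For the last [i] the right-hand side is the default [v], which is where the cycle closes up. *)
have next_c i : i < size s -> next c (nth v s i) = nth v s i.+1.
  move=> lti; rewrite next_nth sc // -[nth v s i]/(nth v c i.+1) index_uniq //.
  by case: c_cycle.
have next_v : next c v = nth v s 0 by rewrite /= eqxx.
have nth_v i : i < size s -> nth v s i <> v.
  by move=> lti E; move: vs; rewrite -{1}E mem_nth.
have e_next i : i.+1 < size s -> e (nth v s i) (nth v s i.+1).
  move=> lti; have := c_path; rewrite rcons_path => /andP[/(pathP v)/(_ i.+1 lti) ee _].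
  exact: ee.
apply: (lrep_extend (v := v)) => //.
- move=> x i xS lti; split=> [ex|[-> [->//|iE]]]; last first.
    suff -> : nth v s i = last v s by [].
    by rewrite -nth_last -iE.
  have xv : x = v.
    apply: (S_ear (sS _) uS _ xS vS ex evu); first exact: mem_nth.
    by rewrite connect_sym_outside connect_s ?mem_nth.
  split=> //; rewrite xv in ex.
  have := cactus_no_chord c_cycle (mem_head _ _) (sc i lti) ex.
  rewrite next_v next_c // => -[/eqP|iv].
    by rewrite nth_uniq // => /eqP <-; left.
  right; apply/eqP; rewrite eqn_leq lti leqNgt; apply/negP => lti'.
  exact: nth_v lti' iv.
- move=> i j ltij ltj; have lti := ltn_trans ltij ltj.
  split=> [ee|jE]; last by rewrite jE; apply: e_next; rewrite -jE.
  have := cactus_no_chord c_cycle (sc i lti) (sc j ltj) ee.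
  rewrite !next_c // => -[/eqP|].
    by rewrite nth_uniq //; [move/eqP | apply: leq_ltn_trans ltj].
  have [ltj'|gej] := ltnP j.+1 (size s).
    by move/eqP; rewrite nth_uniq // => /eqP; lia.
  by rewrite nth_default // => /esym/(nth_v _ lti).
Qed.

End Step.

Lemma grow_ear_free S P : ear_free S -> lrep e S P -> S != set0 -> S != setT ->
  exists S' P', [/\ ear_free S', lrep e S' P' & S \proper S'].
Proof.
move=> S_ear rP S0 ST; have [v [u [vS uS evu]]] := boundary_edge S0 ST.
have proper p : S \proper S :|: [set z in u :: p].
  rewrite properE subsetUl; apply/subsetPn; exists u => //.
  by rewrite !inE eqxx orbT.
have [/existsP[w /and4P[wS uw evw wu]]|no_cycle] :=
  boolP [exists w, [&& w \notin S, connect (outside S) u w, e v w & w != u]].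
  case/connectP: uw => p0 /shortenP[p pp up _] wE.
  have p_neq0 : p != [::] by apply: contraNneq wu => p_nil; rewrite wE p_nil.
  rewrite wE in evw.
  have [P' rP'] := lrep_extend_cycle S_ear vS uS evu pp up p_neq0 evw rP.
  exists (S :|: [set z in u :: p]), P'; split=> //.
  exact: (ear_free_cycle S_ear vS uS evu pp up p_neq0 evw).
have [P' rP'] := lrep_extend1 S_ear vS uS evu rP.
exists (S :|: [set z in [:: u]]), P'; split=> //.
apply: (ear_free_add1 S_ear vS uS evu) => w wS uw evw.
apply/eqP; apply: contraNT no_cycle => wu.
by apply/existsP; exists w; rewrite wS uw evw wu.
Qed.

End Cactus.

Theorem theorem5p9 (T : finType) (e : rel T) : cactus e -> in_B1m e.
Proof.
move=> e_cactus; case: (pickP T) => [x0 _|T0]; last first.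
  (* Without vertices all conditions are vacuous, although [[::]] is not a grid path. *)
  by exists (fun=> [::]); split; [split|] => x; have := T0 x.
(* Induction on the number of vertices not yet drawn, starting from a single vertex. *)
suff grow n S P : #|~: S| < n -> ear_free e S -> lrep e S P -> S != set0 -> in_B1m e.
  apply: (grow _ [set x0] _ (ltnSn _) (@ear_free_set1 _ _ x0) (lrep_set1 e x0)).
  by apply/set0Pn; exists x0; rewrite inE.
elim: n S P => // n IH S P leS S_ear rP S0.
have [ST|ST] := eqVneq S setT; first by rewrite ST in rP; apply: lrep_in_B1m rP.
have [S' [P' [S'_ear rP' SS']]] := grow_ear_free e_cactus S_ear rP S0 ST.
apply: (IH S' P') => //.
  by rewrite -ltnS (leq_trans _ leS) // ltnS proper_card // properC.
by have := proper_sub SS'; apply: contraTneq => ->; rewrite subset0.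
Qed.
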